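(* Let $m\ge1$ and $p\ge1$. There is an online algorithm for the $\ell_p$-norm load balancing problem in the mixed stochastic–adversarial model whose expected load satisfies $$\mathbb{E}\Big\|\sum_{t=1}^n v_t\Big\|_p\;\le\;O(1)\cdot\mathrm{OPT}_{Stoch}+O(\min\{p,\log m\})\cdot\mathrm{OPT}_{Adv}+O\big(\min\{p,\log m\}\,m^{1/p}\big),$$ where $O(\cdot)$ hides absolute constants independent of $n,m,p$ and the instance.
   Context: $\ell_p$-norm load balancing: there are $n$ time steps ($n$ known). At time $t$ a set $V_t\subseteq[0,1]^m$ is revealed, and the algorithm must choose $v_t\in V_t$ using only $V_1,\dots,V_t$; the load is $\|\sum_{t=1}^n v_t\|_p$. Mixed model: $[n]$ is partitioned arbitrarily into $Adv$ and $Stoch$, fixed in advance and unknown to the algorithm. For $t\in Adv$, $V_t$ is chosen by an adversary in advance (non-adaptively). There is an unknown distribution $\mathcal{D}$ over subsets of $[0,1]^m$, and for $t\in Stoch$, $V_t$ is drawn independently from $\mathcal{D}$. Define $\mathrm{OPT}_{Adv}:=\min\{\|\sum_{t\in Adv}v_t\|_p: v_t\in V_t\ \forall t\in Adv\}$ and $\mathrm{OPT}_{Stoch}:=\inf_{v^*}\mathbb{E}\|\sum_{t\in Stoch}v^*(V_t)\|_p$, the infimum over all maps $v^*$ sending each set $V\subseteq[0,1]^m$ to a point $v^*(V)\in V$.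
   Formalization: The factor log m is read as max{1, ln m}; with the literal log 1 = 0 the bound fails for m = 1 (all steps adversarial with V_t = {1}: load n, right side 0), while for m ≥ 2 the two readings agree up to an absolute constant. *)

(* Defs.v *)
From mathcomp Require Export all_boot all_order all_algebra.
From mathcomp Require Export all_classical all_reals all_analysis.
From mathcomp Require Export measurable_realfun.
Set Implicit Arguments.
Unset Strict Implicit.
Unset Printing Implicit Defensive.
Import Order.TTheory GRing.Theory Num.Theory.
Import numFieldNormedType.Exports.
Local Open Scope classical_set_scope.
Local Open Scope ring_scope.

Definition pnorm (R : realType) (m : nat) (p : R) (v : 'rV[R]_m) : R :=
  (\sum_(i < m) `|v ord0 i| `^ p) `^ p^-1.

(* The factor min {p, log m}, with log m read as max {1, ln m}. For m >= 2 this
   agrees with min {p, ln m} up to an absolute constant; for m = 1 the literal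
   factor would be 0, although the load is then at least OPT_Adv. *)
Definition min_p_log (R : realType) (p : R) (m : nat) : R :=
  Num.min p (Num.max 1 (ln m%:R)).

Definition job (R : realType) (m : nat) (V : set 'rV[R]_m) : Prop :=
  V !=set0 /\ (forall v, V v -> forall i, 0 <= v ord0 i <= 1).

(* A deterministic online algorithm maps the sequence [:: V_1; ...; V_t] of the
   sets revealed so far to its choice v_t. *)
Definition online_alg (R : realType) (m : nat) : Type :=
  seq (set 'rV[R]_m) -> 'rV[R]_m.

Definition run (R : realType) (m n : nat) (alg : online_alg R m)
    (V : 'I_n -> set 'rV[R]_m) (t : 'I_n) : 'rV[R]_m :=
  alg [seq V s | s : 'I_n <- enum 'I_n & (s <= t)%N].

Definition valid_alg (R : realType) (m n : nat) (alg : online_alg R m) : Prop :=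
  forall V : 'I_n -> set 'rV[R]_m, (forall t, job (V t)) ->
  forall t, V t (run alg V t).

(* A selection v* is an arbitrary map and V_t need not be closed, so the loads
   need not be measurable; expectations of nonnegative functions are therefore
   outer expectations, which are the usual ones on measurable functions
   (outer_expectationE). *)
Definition outer_expectation d (T : measurableType d) (R : realType)
    (P : probability T R) (f : T -> R) : \bar R :=
  ereal_inf [set (\int[P]_x g x)%E | g in
    [set g : T -> \bar R | measurable_fun [set: T] g /\
                           forall x, ((f x)%:E <= g x)%E]].

Lemma outer_expectationE d (T : measurableType d) (R : realType)
    (P : probability T R) (f : T -> R) :
  measurable_fun [set: T] f -> (forall x, 0 <= f x) ->
  outer_expectation P f = ('E_P[f])%E.
Proof.
move=> mf f0; rewrite unlock; apply/eqP; rewrite eq_le; apply/andP; split.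
  apply: ereal_inf_lbound; exists (EFin \o f) => //.
  by split => //; apply/measurable_EFinP.
apply: le_ereal_inf_tmp => _ [g [mg fg] <-].
apply: ge0_le_integral => //; first by move=> x _; rewrite lee_fin.
  by apply/measurable_EFinP.
Qed.

(* Random sets: Effros measurability, i.e. hitting an open set is an event.
   The law D of x together with V is then a distribution over sets. *)
Definition random_set d (T : measurableType d) (R : realType) (m : nat)
    (V : T -> set 'rV[R]_m) : Prop :=
  forall G : set 'rV[R]_m, open G -> measurable [set x | V x `&` G !=set0].

Definition iid_on dO (Omega : measurableType dO) d (T : measurableType d)
    (R : realType) (P : probability Omega R) (D : probability T R) (n : nat)
    (S : {set 'I_n}) (X : 'I_n -> {RV P >-> T}) : Prop :=
  (forall t, t \in S -> forall B : set T, measurable B ->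
     distribution P (X t) B = D B) /\
  (forall (J : {set 'I_n}) (B : 'I_n -> set T), J \subset S ->
     (forall t, measurable (B t)) ->
     P (\bigcap_(t in [set` J]) (X t @^-1` B t)) =
     (\prod_(t in J) P (X t @^-1` B t))%E).

Definition opt_adv (R : realType) (m n : nat) (p : R) (Adv : {set 'I_n})
    (U : 'I_n -> set 'rV[R]_m) : \bar R :=
  ereal_inf [set (pnorm p (\sum_(t in Adv) v t))%:E | v in
    [set v : 'I_n -> 'rV[R]_m | forall t, t \in Adv -> U t (v t)]].

Definition opt_stoch dO (Omega : measurableType dO) (R : realType) (m n : nat)
    (P : probability Omega R) (p : R) (Stoch : {set 'I_n})
    (V : 'I_n -> Omega -> set 'rV[R]_m) : \bar R :=
  ereal_inf
    [set outer_expectation P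
           (fun w => pnorm p (\sum_(t in Stoch) vstar (V t w)))
       | vstar in [set vstar : set 'rV[R]_m -> 'rV[R]_m |
                   forall W, job W -> W (vstar W)]].

(* Main.v *)
Require Import Defs.
From mathcomp Require Import ring lra.
Set Implicit Arguments.
Unset Strict Implicit.
Unset Printing Implicit Defensive.
Import Order.TTheory GRing.Theory Num.Theory.
Import numFieldNormedType.Exports.
Local Open Scope classical_set_scope.
Local Open Scope ring_scope.

(** Put r = min_p_log p m; on m coordinates the l_p and l_r norms agree up to a
    factor e. The algorithm is greedy for the smoothed norm |A|_r, where A is
    the load shifted by r in each coordinate: it minimizes <A^(r-1), v> over the
    revealed set. The shift makes the gradient of the norm stable under one step,
    so each step increases the norm by at most e <(A / |A|)^(r-1), v>.

    In a stochastic step, the weights are independent of the current set and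
    have dual norm at most 1, so the expected increase is at most
    e OPT_Stoch / |Stoch|, without a factor r.

    In the adversarial steps, the normalized weights are not monotone, but their
    coordinatewise supremum has dual norm at most r |A_n| / |A_0|. Adding to A a
    constant coordinate of order r OPT_Adv, for the analysis only, makes the total
    adversarial increase at most half of the final norm.

    The sets need not be closed and choices from them need not be measurable, so
    the algorithm rounds each set to the subset of a finite grid lying just below
    it; its state is then a finite-valued measurable function of the past. *)

(** * Young and Hoelder inequalities for real powers *)

Section Norms.
Context {R : realType}.
Implicit Types (r a b x y c : R).

Lemma powRVK r x : 1 <= r -> 0 <= x -> (x `^ r^-1) `^ r = x.
Proof.
by move=> r1 x0; rewrite -powRrM mulVf ?powRr1// gt_eqF// (lt_le_trans _ r1).
Qed.

Lemma powRKV r x : 1 <= r -> 0 <= x -> (x `^ r) `^ r^-1 = x.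
Proof.
by move=> r1 x0; rewrite -powRrM divff ?powRr1// gt_eqF// (lt_le_trans _ r1).
Qed.

Lemma ler_powRl r x y : 0 <= r -> 0 <= x -> x <= y -> x `^ r <= y `^ r.
Proof.
by move=> r0 x0 xy; apply: ge0_ler_powR => //; rewrite nnegrE// (le_trans x0).
Qed.

Lemma powR_div r x y : 0 <= x -> 0 <= y -> (x / y) `^ r = x `^ r / y `^ r.
Proof.
move=> x0 y0; rewrite powRM ?invr_ge0//; congr (_ * _).
by rewrite -(powR_inv1 y0) -powRrM mulN1r powRN.
Qed.

(** Young's inequality for the exponents [r / (r - 1)] and [r], scaled by [r]; it is also the
    tangent-line inequality for the convex function [x ^ r] at [a]. The case [r = 1], where the
    first exponent degenerates, is split off. *)
Lemma powR_young r a b : 1 <= r -> 0 <= a -> 0 <= b ->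
  r * (a `^ (r - 1) * b) <= (r - 1) * a `^ r + b `^ r.
Proof.
rewrite le_eqVlt => /predU1P[<- a0 b0|r1 a0 b0].
  by rewrite subrr powRr0 !powRr1// !mul1r mul0r add0r.
have r0 : 0 < r by lra.
have r10 : 0 < r - 1 by lra.
have := @conjugate_powR R (a `^ (r - 1)) b (r / (r - 1)) r (powR_ge0 _ _) b0.
rewrite divr_gt0// => /(_ isT r0).
have -> : (r / (r - 1))^-1 + r^-1 = 1 by field; rewrite !gt_eqF.
move=> /(_ erefl); rewrite -powRrM.
have -> : (r - 1) * (r / (r - 1)) = r by field; rewrite gt_eqF.
rewrite -(ler_pM2l r0) => /le_trans; apply; rewrite le_eqVlt; apply/orP; left.
by apply/eqP; field; rewrite !gt_eqF.
Qed.

Lemma powR_split r x : 1 <= r -> 0 <= x -> x `^ (r - 1) * x = x `^ r.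
Proof. by move=> r1 x0; rewrite mulrC mulr_powRB1// (lt_le_trans _ r1). Qed.

Lemma powR_superadditive r x y : 1 <= r -> 0 <= x -> 0 <= y ->
  x `^ r + y `^ r <= (x + y) `^ r.
Proof.
move=> r1 x0 y0; have xy0 := addr_ge0 x0 y0.
rewrite -(powR_split r1 x0) -(powR_split r1 y0) -(powR_split r1 xy0) mulrDr.
by rewrite lerD// ler_wpM2r// ler_powRl ?subr_ge0// ?lerDl ?lerDr.
Qed.

End Norms.

(** * The l_r norm with one extra constant coordinate *)

Section Ell.
Context {R : realType} {m : nat}.
Implicit Types (r c x : R) (A B b g : 'I_m -> R).

(* The constant [c] acts as one more coordinate, which never changes. *)
Definition ell r c A : R := (c + \sum_i A i `^ r) `^ r^-1.

Lemma ell_ge0 r c A : 0 <= ell r c A.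
Proof. exact: powR_ge0. Qed.

Lemma sum_powR_ge0 r A : 0 <= \sum_i A i `^ r.
Proof. by apply: sumr_ge0 => i _; exact: powR_ge0. Qed.

Lemma ell_powR r c A : 1 <= r -> 0 <= c ->
  ell r c A `^ r = c + \sum_i A i `^ r.
Proof. by move=> r1 c0; rewrite powRVK// addr_ge0// sum_powR_ge0. Qed.

Lemma le_ell r c A B : 1 <= r -> 0 <= c -> (forall i, 0 <= A i <= B i) ->
  ell r c A <= ell r c B.
Proof.
move=> r1 c0 AB; apply: ler_powRl.
- by rewrite invr_ge0; lra.
- by rewrite addr_ge0// sum_powR_ge0.
- rewrite lerD2l; apply: ler_sum => i _; have /andP[? ?] := AB i.
  by apply: ler_powRl => //; lra.
Qed.

Lemma le_ellc r c A : 1 <= r -> 0 <= c -> ell r 0 A <= ell r c A.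
Proof.
move=> r1 c0; apply: ler_powRl; rewrite ?invr_ge0 ?add0r ?sum_powR_ge0//; first by lra.
by rewrite lerDr.
Qed.

Lemma ell_coord r A i : 1 <= r -> 0 <= A i -> A i <= ell r 0 A.
Proof.
move=> r1 A0; rewrite -[leLHS](powRKV r1)//; apply: ler_powRl => //.
- by rewrite invr_ge0; lra.
- exact: powR_ge0.
rewrite add0r (bigD1 i)//= lerDl; apply: sumr_ge0 => j _; exact: powR_ge0.
Qed.

Lemma ell_eq0 r A : 1 <= r -> (forall i, 0 <= A i) -> ell r 0 A = 0 ->
  forall i, A i = 0.
Proof.
move=> r1 A0 E i; apply/eqP; rewrite eq_le A0 andbT -[leRHS]E.
exact: ell_coord.
Qed.

Lemma ell_cst r x : 1 <= r -> 0 <= x ->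
  ell r 0 (fun=> x) = x * m%:R `^ r^-1.
Proof.
move=> r1 x0; rewrite /ell add0r sumr_const card_ord -[X in X `^ _]mulr_natr powRM ?powR_ge0//.
by rewrite powRKV.
Qed.

Lemma ell_add_cst_le r x A : 1 <= r -> 0 <= x -> 
  ell r (x `^ r) A <= x + ell r 0 A.
Proof.
move=> r1 x0; rewrite -[leRHS](powRKV r1) ?addr_ge0 ?ell_ge0//.
apply: ler_powRl.
- by rewrite invr_ge0; lra.
- by rewrite addr_ge0 ?powR_ge0 ?sum_powR_ge0.
have := powR_superadditive r1 x0 (ell_ge0 r 0 A).
by rewrite ell_powR// add0r.
Qed.

Lemma le_cst_ell r x A : 1 <= r -> 0 <= x -> x <= ell r (x `^ r) A.
Proof.
move=> r1 x0; rewrite -[leLHS](powRKV r1)//; apply: ler_powRl.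
- by rewrite invr_ge0; lra.
- exact: powR_ge0.
by rewrite lerDl sum_powR_ge0.
Qed.

(** Young is applied in each coordinate to [A i / N] and [b i / B]; the right-hand sides add up to
    at most [(r - 1) + 1 = r]. *)
Lemma powR_holder r (N B : R) A b : 1 <= r -> 0 < N -> 0 < B ->
  (forall i, 0 <= A i) -> (forall i, 0 <= b i) ->
  \sum_i A i `^ r <= N `^ r -> \sum_i b i `^ r <= B `^ r ->
  \sum_i A i `^ (r - 1) * b i <= N `^ (r - 1) * B.
Proof.
move=> r1 N0 B0 A0 b0 AN bB.
have r0 : 0 < r by lra.
have NB : 0 < N `^ (r - 1) * B by rewrite mulr_gt0// powR_gt0.
rewrite -(ler_pM2l (_ : 0 < r * (N `^ (r - 1) * B)^-1)); last first.
  by rewrite mulr_gt0 ?invr_gt0.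
rewrite mulr_sumr -mulrA mulVf ?gt_eqF// mulr1.
apply: (@le_trans _ _ (\sum_i ((r - 1) * (A i `^ r / N `^ r) + b i `^ r / B `^ r))).
  apply: ler_sum => i _.
  have := powR_young r1 (divr_ge0 (A0 i) (ltW N0)) (divr_ge0 (b0 i) (ltW B0)).
  rewrite !(powR_div _ (A0 i) (ltW N0)) (powR_div _ (b0 i) (ltW B0)).
  apply: le_trans; rewrite le_eqVlt; apply/orP; left; apply/eqP.
  have NN : N `^ (r - 1) != 0 by rewrite gt_eqF// powR_gt0.
  by field; rewrite NN gt_eqF.
rewrite big_split/= -mulr_sumr -!mulr_suml.
have H1 : (\sum_i A i `^ r) / N `^ r <= 1 by rewrite ler_pdivrMr ?powR_gt0// mul1r.
have H2 : (\sum_i b i `^ r) / B `^ r <= 1 by rewrite ler_pdivrMr ?powR_gt0// mul1r.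
have : (r - 1) * ((\sum_i A i `^ r) / N `^ r) <= (r - 1) * 1.
  by rewrite ler_wpM2l// subr_ge0.
by lra.
Qed.

(** [N] need not be the norm of [A]: it may include the constant coordinate, or be an upper bound on
    the norm of a supremum of weights. *)
Lemma ell_holder r (N : R) A b : 1 <= r -> 0 < N -> \sum_i A i `^ r <= N `^ r ->
  (forall i, 0 <= A i) -> (forall i, 0 <= b i) ->
  \sum_i A i `^ (r - 1) * b i <= N `^ (r - 1) * ell r 0 b.
Proof.
move=> r1 N0 AN A0 b0.
have := ell_ge0 r 0 b; rewrite le_eqVlt => /predU1P[B0|B0].
  rewrite big1 ?mulr_ge0 ?powR_ge0 ?ell_ge0 ?(ltW N0)// => i _.
  by rewrite (ell_eq0 r1 b0 (esym B0)) mulr0.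
by apply: powR_holder => //; rewrite ell_powR// ?add0r.
Qed.

(** The tangent of [x ^ r] at the old norm bounds the increase of the norm by the increase of its
    r-th power; the tangent at [A i + g i] bounds each coordinate's share of the latter. As
    [A i >= r] and [g i <= 1], the factor [(1 + g i / A i) ^ (r - 1)] is at most e, so the weights
    may be taken at the old load. *)
Lemma ell_step r c A g : 1 <= r -> 0 <= c -> 0 < ell r c A ->
  (forall i, r <= A i) -> (forall i, 0 <= g i <= 1) ->
  ell r c (fun i => A i + g i) <=
  ell r c A + expR 1 * ((\sum_i A i `^ (r - 1) * g i) / ell r c A `^ (r - 1)).
Proof.
move=> r1 c0 N0 Ar g01.
have NE := ell_powR A r1 c0; have NE' := ell_powR (fun i => A i + g i) r1 c0.
move: N0 NE (ell_ge0 r c (fun i => A i + g i)) NE'.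
move: (ell r c A) (ell r c (fun i => A i + g i)) => N N' N0 NE N0' NE'.
have r0 : 0 < r by lra.
have P0 : 0 < N `^ (r - 1) by exact: powR_gt0.
have tangent : r * (N `^ (r - 1) * (N' - N)) <= N' `^ r - N `^ r.
  have := powR_young r1 (ltW N0) N0'.
  rewrite mulrBr (powR_split r1 (ltW N0)); lra.
have grow i : (A i + g i) `^ r - A i `^ r <= r * (expR 1 * (A i `^ (r - 1) * g i)).
  have /andP[g0 g1] := g01 i; have Ai := Ar i.
  have A0 : 0 < A i by lra.
  have B0 : 0 <= A i + g i by lra.
  have Y := powR_young r1 B0 (ltW A0).
  have S := powR_split r1 B0.
  have gA : 0 <= g i / A i by rewrite divr_ge0// ltW.
  have AE : A i + g i = (1 + g i / A i) * A i by field; rewrite gt_eqF.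
  have gA0 : 0 <= 1 + g i / A i by lra.
  have L : (A i + g i) `^ (r - 1) <= expR 1 * A i `^ (r - 1).
    rewrite AE (powRM _ gA0 (ltW A0)) ler_wpM2r ?powR_ge0//.
    apply: (@le_trans _ _ (expR (g i / A i) `^ (r - 1))).
      by apply: ler_powRl; [lra|lra|exact: expR_ge1Dx].
    rewrite -expRM ler_expR mulrAC ler_pdivrMr// mul1r.
    have : g i * (r - 1) <= 1 * (r - 1) by rewrite ler_wpM2r// subr_ge0.
    by lra.
  rewrite mulrA; apply: (@le_trans _ _ (r * ((A i + g i) `^ (r - 1) * g i))); last first.
    by rewrite -mulrA ler_pM2l// mulrA ler_wpM2r.
  move: Y; rewrite -[X in _ * (_ * X) <= _](addrK (g i)) mulrBr S; lra.
have : N' `^ r - N `^ r <= r * (expR 1 * \sum_i A i `^ (r - 1) * g i).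
  rewrite NE NE' opprD addrACA subrr add0r -sumrB !mulr_sumr.
  exact: ler_sum.
move=> /(le_trans tangent); rewrite (ler_pM2l r0) => H.
by rewrite -lerBlDl mulrA ler_pdivlMr// mulrC.
Qed.

End Ell.

(** * The smoothed norm as a potential *)

Section Potential.
Context {R : realType} {m : nat} (r c : R) (A : nat -> 'I_m -> R)
  (Phi : nat -> R).
Hypotheses (r1 : 1 <= r) (c0 : 0 <= c).
Hypothesis A_ge : forall t i, r <= A t i.
Hypothesis A_inc : forall t i, 0 <= A t.+1 i - A t i <= 1.

Hypothesis PhiE : forall t, Phi t = ell r c (A t).
Hypothesis Phi0_gt0 : 0 < Phi 0.

Let r_gt0 : 0 < r.
Proof. exact: lt_le_trans r1. Qed.

Let r1_ge0 : 0 <= r - 1.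
Proof. by rewrite subr_ge0. Qed.

Let A_ge0 t i : 0 <= A t i.
Proof. exact: le_trans (ltW r_gt0) (A_ge t i). Qed.

Let A_le t i : A t i <= A t.+1 i.
Proof. by have /andP[] := A_inc t i; rewrite subr_ge0. Qed.

Let Phi_le t : Phi t <= Phi t.+1.
Proof. by rewrite !PhiE; apply: le_ell => // i; rewrite A_ge0 A_le. Qed.

Let Phi0_le t : Phi 0 <= Phi t.
Proof. by elim: t => [|t IH]; [exact: lexx|exact: le_trans IH (Phi_le t)]. Qed.

Let Phi_gt0 t : 0 < Phi t.
Proof. exact: lt_le_trans (Phi0_le t). Qed.

(* An upper bound on all the normalized powers [(A s i / Phi s) `^ r], s <= t,
   whose total over [i] grows only with [Phi]. *)
Let Z t i := (A 0 i / Phi 0) `^ r +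
  \sum_(0 <= s < t) (A s.+1 i `^ r - A s i `^ r) / Phi s.+1 `^ r.

Let inc_ge0 s i : 0 <= (A s.+1 i `^ r - A s i `^ r) / Phi s.+1 `^ r.
Proof.
by rewrite divr_ge0 ?powR_ge0// subr_ge0 ler_powRl// ltW.
Qed.

Let Z_le s t i : (s <= t)%N -> Z s i <= Z t i.
Proof.
move=> st; rewrite lerD2l [leRHS](big_cat_nat (leq0n s) st)/= lerDl.
by apply: sumr_ge0 => *; exact: inc_ge0.
Qed.

(** The new term of [Z] replaces [A t i ^ r] by [A t.+1 i ^ r] over the denominator [Phi t.+1 ^ r];
    passing from [Phi t] to the larger [Phi t.+1] only shrinks the rest. *)
Let Z_ge t i : (A t i / Phi t) `^ r <= Z t i.
Proof.
elim: t => [|t IH]; first by rewrite /Z big_nil addr0.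
rewrite /Z big_nat_recr//= addrA -/(Z t i) mulrBl.
rewrite (powR_div _ (A_ge0 _ _) (ltW (Phi_gt0 _))) addrCA lerDl subr_ge0.
apply: le_trans IH; rewrite (powR_div _ (A_ge0 _ _) (ltW (Phi_gt0 _))).
apply: ler_wpM2l; first exact: powR_ge0.
rewrite lef_pV2 ?posrE ?powR_gt0//.
by apply: ler_powRl; [exact: ltW|exact: ltW|exact: Phi_le].
Qed.

Let Phi_powR t : Phi t `^ r = c + \sum_i A t i `^ r.
Proof. by rewrite PhiE ell_powR. Qed.

(** Summed over [i], the numerators give [Phi t.+1 ^ r - Phi t ^ r], as [c] cancels. The tangent at
    [Phi t.+1] turns this into a relative increase of [Phi], whose denominator is then lowered to
    [Phi 0]. *)
Let sum_inc t : \sum_i (A t.+1 i `^ r - A t i `^ r) / Phi t.+1 `^ r <=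
  r * ((Phi t.+1 - Phi t) / Phi 0).
Proof.
rewrite -mulr_suml sumrB.
have -> : \sum_i A t.+1 i `^ r - \sum_i A t i `^ r = Phi t.+1 `^ r - Phi t `^ r.
  by rewrite !Phi_powR; ring.
rewrite ler_pdivrMr ?powR_gt0//.
have P0 := Phi_gt0 t.+1.
have := powR_young r1 (ltW P0) (ltW (Phi_gt0 t)).
have S := powR_split r1 (ltW P0).
move=> Y; have : Phi t.+1 `^ r - Phi t `^ r <=
    r * (Phi t.+1 `^ (r - 1) * (Phi t.+1 - Phi t)).
  by rewrite mulrBr S; lra.
move=> /le_trans; apply.
rewrite -mulrA (ler_pM2l r_gt0).
rewrite -S [leRHS](_ : _ = Phi t.+1 `^ (r - 1) * (Phi t.+1 - Phi t) *
  (Phi t.+1 / Phi 0)); last by ring.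
rewrite ler_peMr ?mulr_ge0 ?powR_ge0 ?subr_ge0//.
by rewrite ler_pdivlMr// mul1r.
Qed.

Let sum_Z t : \sum_i Z t i <= r * (Phi t / Phi 0).
Proof.
rewrite big_split/= exchange_big/=.
have H1 : \sum_i (A 0 i / Phi 0) `^ r <= 1.
  under eq_bigr => i _ do rewrite (powR_div _ (A_ge0 0 i) (ltW Phi0_gt0)).
  by rewrite -mulr_suml ler_pdivrMr ?powR_gt0// mul1r Phi_powR lerDr.
have H2 : \sum_(0 <= s < t) \sum_i (A s.+1 i `^ r - A s i `^ r) / Phi s.+1 `^ r <=
    r * ((Phi t - Phi 0) / Phi 0).
  rewrite -(telescope_sumr Phi (leq0n t)) mulr_suml mulr_sumr.
  by apply: ler_sum => s _; exact: sum_inc.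
(* The initial term contributes at most 1, which the [- r] left by telescoping absorbs. *)
move: H2; rewrite mulrBl divff ?gt_eqF// => H2; have := r1; lra.
Qed.

(** All normalized loads lie below the time-independent [W], so a single Hoelder inequality handles
    the sum of all the [b t]. It gives the factor [X ^ ((r - 1) / r)], at most [X] because
    [X >= 1]. *)
Lemma sum_normalized_weights n (Q : pred 'I_n) (b : 'I_n -> 'I_m -> R) :
  (forall t i, Q t -> 0 <= b t i) ->
  \sum_(t < n | Q t) (\sum_i A t i `^ (r - 1) * b t i) / Phi t `^ (r - 1) <=
  r * (Phi n / Phi 0) * ell r 0 (fun i => \sum_(t < n | Q t) b t i).
Proof.
move=> b0; set X := r * (Phi n / Phi 0).
have X1 : 1 <= X.
  rewrite (le_trans r1)// -[leLHS]mulr1 (ler_pM2l r_gt0).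
  by rewrite ler_pdivlMr// mul1r.
have X0 : 0 < X by exact: lt_le_trans X1.
have Z0 i : 0 <= Z n i by apply: le_trans (Z_ge n i); exact: powR_ge0.
pose W i := Z n i `^ r^-1.
have AW (t : 'I_n) i : A t i / Phi t <= W i.
  rewrite -[leLHS](powRKV r1) ?divr_ge0 ?(ltW (Phi_gt0 _))// /W.
  apply: ler_powRl.
  - by rewrite invr_ge0 ltW.
  - exact: powR_ge0.
  - by rewrite (le_trans (Z_ge t i))// Z_le// ltnW.
have XN : 0 < X `^ r^-1 by exact: powR_gt0.
apply: (@le_trans _ _ (\sum_i W i `^ (r - 1) * \sum_(t < n | Q t) b t i)).
  under [leRHS]eq_bigr do rewrite mulr_sumr.
  rewrite exchange_big/=; apply: ler_sum => t Qt.
  rewrite mulr_suml; apply: ler_sum => i _.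
  rewrite mulrAC ler_wpM2r ?b0//.
  rewrite -(powR_div _ (A_ge0 t i) (ltW (Phi_gt0 t))).
  by apply: ler_powRl => //; rewrite divr_ge0// ltW.
apply: (@le_trans _ _ ((X `^ r^-1) `^ (r - 1) *
    ell r 0 (fun i => \sum_(t < n | Q t) b t i))).
  apply: ell_holder => //.
  - rewrite (powRVK r1 (ltW X0)) (le_trans _ (sum_Z n))//.
    by apply: ler_sum => i _; rewrite /W (powRVK r1 (Z0 i)).
  - by move=> i; exact: powR_ge0.
  - by move=> i; apply: sumr_ge0 => t Qt; exact: b0.
apply: ler_wpM2r; first exact: ell_ge0.
rewrite -powRrM; apply: ler1_powR => //.
by rewrite mulrBr mulVf ?mulr1 ?gerBl ?invr_ge0 ?gt_eqF// ltW.
Qed.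

(** [Q] marks the adversarial steps and [b] a competing choice there. The increments of [Phi] are
    telescoped, and the adversarial part is absorbed into the left-hand side. *)
Lemma potential_bound n (Q : pred 'I_n) (b : 'I_n -> 'I_m -> R) :
  (forall t i, Q t -> 0 <= b t i) ->
  (forall t : 'I_n, Q t -> \sum_i A t i `^ (r - 1) * (A t.+1 i - A t i) <=
                \sum_i A t i `^ (r - 1) * b t i) ->
  2 * expR 1 * r * ell r 0 (fun i => \sum_(t < n | Q t) b t i) <= Phi 0 ->
  Phi n <= 2 * Phi 0 + 2 * expR 1 * \sum_(t < n | ~~ Q t)
    (\sum_i A t i `^ (r - 1) * (A t.+1 i - A t i)) / Phi t `^ (r - 1).
Proof.
move=> b0 greedy big.
pose q t := (\sum_i A t i `^ (r - 1) * (A t.+1 i - A t i)) / Phi t `^ (r - 1).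
have step t : Phi t.+1 - Phi t <= expR 1 * q t.
  have := Phi_gt0 t; rewrite PhiE => /(ell_step r1 c0).
  move=> /(_ (fun i => A t.+1 i - A t i) (A_ge t) (A_inc t)).
  have -> : ell r c (fun i => A t i + (A t.+1 i - A t i)) = Phi t.+1.
    by rewrite PhiE; congr ell; apply/funext => i; rewrite addrC subrK.
  by rewrite -PhiE lerBlDl.
have e0 := expR_gt0 (1 : R).
have tot : Phi n - Phi 0 <= expR 1 * \sum_(t < n) q t.
  rewrite -(telescope_sumr Phi (leq0n n)) big_mkord mulr_sumr.
  by apply: ler_sum => s _; exact: step.
set B := ell r 0 _ in big.
have adv : \sum_(t < n | Q t) q t <= r * (Phi n / Phi 0) * B.
  apply: le_trans (sum_normalized_weights b0); apply: ler_sum => t Qt.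
  by rewrite ler_wpM2r ?invr_ge0 ?powR_ge0// greedy.
(* The lower bound on [Phi 0] enters here: the adversarial increase is at most [Phi n / 2]. *)
have half : 2 * (expR 1 * (r * (Phi n / Phi 0) * B)) <= Phi n.
  have -> : 2 * (expR 1 * (r * (Phi n / Phi 0) * B)) =
      Phi n * ((2 * expR 1 * r * B) / Phi 0) by ring.
  rewrite -[leRHS]mulr1; apply: ler_wpM2l; first exact: ltW.
  by rewrite ler_pdivrMr// mul1r.
move: tot; rewrite (bigID Q)/= -/q.
have : expR 1 * \sum_(t < n | Q t) q t <= expR 1 * (r * (Phi n / Phi 0) * B).
  by rewrite ler_pM2l.
rewrite -/(q _); set S := \sum_(t < n | ~~ Q t) _.
by rewrite mulrDr -mulrA; lra.
Qed.

End Potential.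

(** * The greedy algorithm on a grid *)

Section NormComparison.
Context {R : realType} {m : nat}.
Implicit Types (r p : R) (A : 'I_m -> R).

Lemma pnormE p (v : 'rV[R]_m) : pnorm p v = ell p 0 (fun i => `|v ord0 i|).
Proof. by rewrite /pnorm /ell add0r. Qed.

Lemma ell_nonincreasing r p A : 1 <= r -> r <= p -> (forall i, 0 <= A i) ->
  ell p 0 A <= ell r 0 A.
Proof.
move=> r1 rp A0; have p1 := le_trans r1 rp.
rewrite -[leRHS](powRKV p1) ?ell_ge0//; apply: ler_powRl.
- by rewrite invr_ge0; lra.
- by rewrite add0r sum_powR_ge0.
have split x : x `^ p = x `^ (p - r) * x `^ r.
  rewrite -powRD ?subrK//; apply/implyP => /eqP; lra.
rewrite add0r split [X in _ * X]ell_powR// add0r mulr_sumr.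
apply: ler_sum => i _; rewrite split ler_wpM2r ?powR_ge0//.
by apply: ler_powRl => //; [lra|exact: ell_coord].
Qed.

Lemma min_p_log_ge1 p : 1 <= p -> 1 <= min_p_log p m.
Proof. by move=> p1; rewrite /min_p_log le_min p1 le_max lexx. Qed.

Lemma min_p_log_le p : min_p_log p m <= p.
Proof. by rewrite /min_p_log ge_min lexx. Qed.

(** If the minimum is not [p], each coordinate is bounded by the l_p norm, which costs a factor
    [m ^ (1 / r)]; this is at most e because [r >= ln m]. *)
Lemma ell_min_p_log p A : (0 < m)%N -> 1 <= p -> (forall i, 0 <= A i) ->
  ell (min_p_log p m) 0 A <= expR 1 * ell p 0 A.
Proof.
move=> m0 p1 A0; have e1 : 1 <= expR 1 :> R by rewrite ltW// pexpR_gt1.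
have r1 := min_p_log_ge1 p1; rewrite /min_p_log in r1 *.
move: r1; rewrite minEle; case: ifP => [_ _|_ r1].
  by rewrite ler_peMl ?ell_ge0.
set r := Num.max _ _ in r1 *.
apply: (@le_trans _ _ (ell r 0 (fun _ : 'I_m => ell p 0 A))).
  by apply: le_ell => // i; rewrite A0 ell_coord.
rewrite ell_cst ?ell_ge0// mulrC ler_wpM2r ?ell_ge0//.
rewrite /powR pnatr_eq0 gtn_eqF// ler_expR mulrC ler_pdivrMr; last lra.
by rewrite mul1r le_max lexx orbT.
Qed.

Lemma powR_min_p_log p : (0 < m)%N -> 1 <= p ->
  m%:R `^ (min_p_log p m)^-1 <= expR 1 * m%:R `^ p^-1 :> R.
Proof.
move=> m0 p1; have := @ell_min_p_log p (fun=> 1) m0 p1 (fun=> ler01).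
by rewrite !ell_cst ?min_p_log_ge1// !mul1r.
Qed.

End NormComparison.

(** * Rounding, the greedy rule and the trajectory of loads *)

Section Algorithm.
Context {R : realType} {m : nat} (n : nat) (r : R).
Implicit Types (A : 'I_m -> R) (V : set 'rV[R]_m).

(** Numerators [0, ..., n + 1] over the denominator [n + 1]: the value 1 is included, and [n]
    roundings lose less than 1 per coordinate. *)
Let grid := {ffun 'I_m -> 'I_n.+2}.
Implicit Types (k : grid) (y : {set grid}).

Definition grid_point k (i : 'I_m) : R := (k i)%:R / n.+1%:R.

(** Only strict upper bounds are imposed, so this set is open and meeting it is an event for a
    random set. *)
Definition below k : set 'rV[R]_m :=
  [set v | forall i, v ord0 i < grid_point k i + n.+1%:R^-1].

(* All that the algorithm uses of a revealed set: a finite, measurable piece of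
   information. *)
Definition profile V : {set grid} := [set k | `[< V `&` below k !=set0 >]].

Definition cost A k : R := \sum_i A i `^ (r - 1) * grid_point k i.

Definition greedy A y : grid := xget [ffun=> ord0]
  [set k | k \in y /\ forall k', k' \in y -> cost A k <= cost A k'].

(** Starting from [r] realizes the shift. Grid points are accumulated instead of the chosen vectors,
    so the state depends on the past profiles alone. *)
Definition loads (s : seq {set grid}) : 'I_m -> R :=
  foldl (fun A y i => A i + grid_point (greedy A y) i) (fun=> r) s.

Definition greedy_alg : online_alg R m := fun s =>
  let A := loads [seq profile V | V <- take (size s).-1 s] in
  let V := last set0 s in
  xget 0 (V `&` below (greedy A (profile V))).

Lemma grid_point_ge0 k i : 0 <= grid_point k i.
Proof. by rewrite divr_ge0. Qed.

Lemma grid_point_le1 k i : grid_point k i <= 1.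
Proof. by rewrite ler_pdivrMr ?ltr0n// mul1r ler_nat -ltnS. Qed.

Lemma cost_ge0 A k : 0 <= cost A k.
Proof.
by apply: sumr_ge0 => i _; rewrite mulr_ge0 ?powR_ge0 ?grid_point_ge0.
Qed.

(** Each coordinate of [v] is rounded down to the grid. *)
Lemma profile_round V v : job V -> V v ->
  exists2 k, k \in profile V & forall i, grid_point k i <= v ord0 i.
Proof.
move=> [_ V01] Vv; have n0 : 0 < n.+1%:R :> R by rewrite ltr0n.
pose f i := Num.truncn (v ord0 i * n.+1%:R).
have f_itv i : (f i)%:R <= v ord0 i * n.+1%:R < (f i).+1%:R.
  have /andP[v0 _] := V01 _ Vv i.
  by apply: truncn_itv; rewrite mulr_ge0.
have fn i : (f i < n.+2)%N.
  have /andP[_ v1] := V01 _ Vv i; have /andP[fv _] := f_itv i.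
  rewrite ltnS -(ler_nat R) (le_trans fv)// -[leRHS]mul1r ler_wpM2r//.
exists [ffun i => Ordinal (fn i)] => [|i]; last first.
  by rewrite /grid_point ffunE/= ler_pdivrMr//; have /andP[] := f_itv i.
rewrite inE; apply/asboolP; exists v; split => // i.
rewrite /grid_point ffunE/= -[X in _ + X]mul1r -mulrDl ltr_pdivlMr// natr1.
by have /andP[] := f_itv i.
Qed.

Lemma profile_neq0 V : job V -> profile V != finset.set0.
Proof.
move=> jV; have [[v Vv] _] := jV.
have [k kV _] := profile_round jV Vv.
by apply/set0Pn; exists k.
Qed.

Lemma greedyP A y : y != finset.set0 ->
  greedy A y \in y /\ forall k, k \in y -> cost A (greedy A y) <= cost A k.
Proof.
move=> /set0Pn[k0 k0y]; rewrite /greedy; case: xgetP => // none.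
have [k ky kmin] := arg_minP (cost A) k0y.
by have := none k; case; split.
Qed.

(** Rounding down only lowers the cost, so the greedy grid point competes with every vector of [V]
    without any error term. *)
Lemma cost_greedy_le A V v : job V -> V v ->
  cost A (greedy A (profile V)) <= \sum_i A i `^ (r - 1) * v ord0 i.
Proof.
move=> jV Vv; have [k kV kv] := profile_round jV Vv.
have [_ /(_ _ kV)/le_trans] := greedyP A (profile_neq0 jV); apply.
by apply: ler_sum => i _; rewrite ler_wpM2l ?powR_ge0.
Qed.

Lemma greedy_algP (s : seq (set 'rV[R]_m)) V : job V ->
  (V `&` below (greedy (loads (map profile s)) (profile V)))
    (greedy_alg (rcons s V)).
Proof.
move=> jV; rewrite /greedy_alg last_rcons size_rcons/= -cats1 take_size_cat//.
case: xgetP => [//|none].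
have [] := greedyP (loads (map profile s)) (profile_neq0 jV).
by rewrite inE => /asboolP[v Vv]; have := none v.
Qed.

(** Time is a natural number, and the history stays constant from [n] on, so that trajectories are
    sequences indexed by [nat]. *)
Definition hist {T} (f : 'I_n -> T) (t : nat) : seq T :=
  [seq f s | s : 'I_n <- enum 'I_n & (s < t)%N].

Lemma filter_enum_ord t : (t <= n)%N ->
  map val [seq s : 'I_n <- enum 'I_n | (s < t)%N] = iota 0 t.
Proof.
move=> tn; rewrite -(filter_map val (fun s => s < t)%N) val_enum_ord.
exact: (filter_iota_ltn 0).
Qed.

Lemma hist0 {T} (f : 'I_n -> T) : hist f 0 = [::].
Proof. by rewrite /hist; elim: (enum _). Qed.

Lemma histS {T} (f : 'I_n -> T) (t : 'I_n) :
  hist f t.+1 = rcons (hist f t) (f t).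
Proof.
rewrite /hist -map_rcons; congr map; apply: (inj_map val_inj).
rewrite map_rcons (filter_enum_ord (ltn_ord t)) (filter_enum_ord (ltnW _))//.
by rewrite -addn1 iotaD cats1.
Qed.

Lemma hist_oversize {T} (f : 'I_n -> T) t : (n <= t)%N -> hist f t.+1 = hist f t.
Proof.
move=> nt; rewrite /hist; congr map; apply: eq_filter => s.
by rewrite ltnS (leq_trans (ltnW (ltn_ord s)) nt) (leq_trans (ltn_ord s) nt).
Qed.

Lemma eq_hist {T} (f g : 'I_n -> T) t :
  (forall s : 'I_n, (s < t)%N -> f s = g s) -> hist f t = hist g t.
Proof.
move=> fg; apply/eq_in_map => s; rewrite mem_filter => /andP[st _].
exact: fg.
Qed.

Lemma run_greedy_alg (V : 'I_n -> set 'rV[R]_m) t : job (V t) ->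
  (V t `&` below (greedy (loads (hist (profile \o V) t)) (profile (V t))))
    (run greedy_alg V t).
Proof.
move=> jV; have := greedy_algP (hist V t) jV.
by rewrite -map_comp -histS.
Qed.

Lemma valid_greedy_alg : valid_alg n greedy_alg.
Proof. by move=> V jV t; have [] := run_greedy_alg (jV t). Qed.

Section Trajectory.
Variable y : 'I_n -> {set grid}.

Definition traj t := loads (hist y t).

Lemma traj0 i : traj 0 i = r.
Proof. by rewrite /traj hist0. Qed.

Lemma trajS (t : 'I_n) i :
  traj t.+1 i = traj t i + grid_point (greedy (traj t) (y t)) i.
Proof. by rewrite /traj histS /loads foldl_rcons. Qed.

Lemma traj_inc t i : 0 <= traj t.+1 i - traj t i <= 1.
Proof.
have [tn|nt] := ltnP t n.
  rewrite (trajS (Ordinal tn)) addrAC subrr add0r.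
  by rewrite grid_point_ge0 grid_point_le1.
by rewrite /traj hist_oversize// subrr lexx ler01.
Qed.

Lemma traj_ge t i : r <= traj t i.
Proof.
elim: t => [|t IH]; first by rewrite traj0.
by apply: le_trans IH _; have /andP[] := traj_inc t i; rewrite subr_ge0.
Qed.

End Trajectory.

Lemma load_le_traj (V : 'I_n -> set 'rV[R]_m) i : 1 <= r ->
  (forall t, job (V t)) ->
  0 <= (\sum_(t < n) run greedy_alg V t) ord0 i <= traj (profile \o V) n i.
Proof.
move=> r1 jV; rewrite summxE; apply/andP; split.
  apply: sumr_ge0 => t _; have [_ V01] := jV t.
  by have /andP[] := V01 _ (valid_greedy_alg jV t) i.
have -> : traj (profile \o V) n i = r + \sum_(t < n)
    grid_point (greedy (traj (profile \o V) t) (profile (V t))) i.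
  rewrite -[LHS](subrK (traj (profile \o V) 0 i)) traj0 addrC; congr (_ + _).
  rewrite -[r](traj0 (profile \o V) i).
  rewrite -(telescope_sumr (fun t => traj (profile \o V) t i) (leq0n n)) big_mkord.
  by apply: eq_bigr => t _; rewrite trajS addrAC subrr add0r.
apply: (@le_trans _ _ (\sum_(t < n) (n.+1%:R^-1 +
    grid_point (greedy (traj (profile \o V) t) (profile (V t))) i))).
  apply: ler_sum => t _; have [_ /(_ i)/ltW] := run_greedy_alg (jV t).
  by rewrite addrC.
(* The rounding errors total at most [n / (n + 1) <= 1 <= r]: the initial shift pays for them. *)
rewrite big_split/= lerD2r (le_trans _ r1)// sumr_const card_ord -mulr_natr.
rewrite mul1r -[leLHS]mulr_natr.
by rewrite ler_pdivrMl ?ltr0n// mulr1 ler_nat.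
Qed.

End Algorithm.

(** * Finite-valued random variables *)

Section FiniteValued.
Context {R : realType} d (Omega : measurableType d) (P : probability Omega R).

Lemma measurable_finite_valued (A : finType) (Z : Omega -> A) (phi : A -> R) :
  (forall a, measurable (Z @^-1` [set a])) ->
  measurable_fun setT (phi \o Z).
Proof.
move=> mZ _ Y mY; rewrite setTI.
have -> : (phi \o Z) @^-1` Y = \bigcup_(a in [set a | Y (phi a)]) Z @^-1` [set a].
  apply/seteqP; split=> [w Yw|w [a Ya Zw]]; first by exists (Z w).
  by rewrite /= Zw.
by apply: fin_bigcup_measurable => //; exact: finite_finset.
Qed.

Lemma integral_finite_valued (A : finType) (Z : Omega -> A) (phi : A -> R) :
  (forall a, measurable (Z @^-1` [set a])) -> (forall a, 0 <= phi a) ->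
  (\int[P]_w (phi (Z w))%:E = \sum_a (phi a)%:E * P (Z @^-1` [set a]))%E.
Proof.
move=> mZ phi0.
transitivity (\int[P]_w (\sum_a (phi a)%:E * (\1_(Z @^-1` [set a]) w)%:E))%E.
  apply: eq_integral => w _; rewrite (bigD1 (Z w))//= big1 ?adde0 => [|a aZ].
    by rewrite indicE mem_set// mule1.
  rewrite indicE memNset ?mule0// => /eqP; rewrite eq_sym; exact/negP.
rewrite ge0_integral_sum//.
- apply: eq_bigr => a _.
  rewrite ge0_integralZl_EFin//; first by rewrite integral_indic// setIT.
  by apply/measurable_EFinP; exact: measurable_indic.
- move=> a; apply: measurable_funeM; apply/measurable_EFinP.
  exact: measurable_indic.
- by move=> a w _; rewrite mule_ge0// lee_fin.
Qed.

Lemma sum_finite_valued (A : finType) (Z : Omega -> A) :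
  (forall a, measurable (Z @^-1` [set a])) ->
  (\sum_a P (Z @^-1` [set a]) = 1)%E.
Proof.
move=> mZ; have := integral_finite_valued mZ (fun=> ler01).
under [RHS]eq_bigr do rewrite mul1e.
rewrite integral_cst// mul1e => <-; exact: probability_setT.
Qed.

End FiniteValued.

(** Given [H = a], the variable [Z] has the law of [Z'] under [D], so the integral is an average
    over [a] of quantities at most [c]. *)
Lemma integral_independent {R : realType} d (Omega : measurableType d)
    (P : probability Omega R) (A B : finType) (H : Omega -> A) (Z : Omega -> B)
    d' (T : measurableType d') (D : probability T R) (Z' : T -> B)
    (phi : A -> B -> R) (c : R) :
  (forall a, measurable (H @^-1` [set a])) ->
  (forall b, measurable (Z @^-1` [set b])) ->
  (forall b, measurable (Z' @^-1` [set b])) ->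
  (forall a b, P (H @^-1` [set a] `&` Z @^-1` [set b]) =
     (P (H @^-1` [set a]) * D (Z' @^-1` [set b]))%E) ->
  (forall a b, 0 <= phi a b) ->
  (forall a, (\int[D]_x (phi a (Z' x))%:E <= c%:E)%E) ->
  (\int[P]_w (phi (H w) (Z w))%:E <= c%:E)%E.
Proof.
move=> mH mZ mZ' ind phi0 le_c.
pose HZ w := (H w, Z w).
have HZE a b : HZ @^-1` [set (a, b)] = H @^-1` [set a] `&` Z @^-1` [set b].
  by apply/seteqP; split=> w /= [<- <-].
have mHZ ab : measurable (HZ @^-1` [set ab]).
  by case: ab => a b; rewrite HZE; exact: measurableI.
rewrite (integral_finite_valued P mHZ (fun ab => phi0 ab.1 ab.2)).
rewrite (_ : \sum_ab _ =
    \sum_a \sum_b (phi a b)%:E * P (HZ @^-1` [set (a, b)]))%E; last first.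
  by rewrite pair_bigA; apply: eq_bigr => -[a b].
apply: (@le_trans _ _ (\sum_a P (H @^-1` [set a]) * c%:E)%E); last first.
  by rewrite -ge0_sume_distrl ?(sum_finite_valued P mH) ?mul1e.
apply: lee_sum => a _.
under eq_bigr do rewrite HZE ind muleCA.
rewrite -ge0_sume_distrr; last by move=> b _; rewrite mule_ge0 ?lee_fin.
by rewrite lee_wpmul2l// -integral_finite_valued.
Qed.

Section RandomProfiles.
Context {R : realType} {m n : nat}.

Lemma open_below (k : {ffun 'I_m -> 'I_n.+2}) : open (below k : set 'rV[R]_m).
Proof.
rewrite openE => v vk.
have near_i (i : 'I_m) : \forall w \near v, (w : 'rV[R]_m) ord0 i < grid_point k i + n.+1%:R^-1.
  have := @coord_continuous R 1 m ord0 i v.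
  move=> /(_ [set x | x < grid_point k i + n.+1%:R^-1]); apply.
  exact: lt_nbhsl.
exact: (filter_forall _ near_i).
Qed.

(** Fixing the profile is a finite combination of the events of hitting, or missing, the open sets
    [below k]. *)
Lemma measurable_profile d (T : measurableType d) (V : T -> set 'rV[R]_m) :
  random_set V ->
  forall y, measurable ((fun x => profile n (V x)) @^-1` [set y]).
Proof.
move=> mV y.
have -> : (fun x => profile n (V x)) @^-1` [set y] =
    \bigcap_(k in [set: {ffun 'I_m -> 'I_n.+2}])
      (if k \in y then [set x | V x `&` below k !=set0]
       else ~` [set x | V x `&` below k !=set0]).
  apply/seteqP; split=> [x <- k _|x Vy].
    by rewrite inE; case: asboolP.
  apply/setP => k; rewrite inE; have := Vy k I.
  by case: ifP => _; case: asboolP.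
apply: fin_bigcap_measurable => [|k _]; first exact: finite_finset.
have mk := mV _ (@open_below k).
by case: ifP => _ //; exact: measurableC.
Qed.

End RandomProfiles.

(** * Independence of the current set from the recorded past *)

Section Independence.
Context {R : realType} dO (Omega : measurableType dO) d (T : measurableType d).
Context (P : probability Omega R) (D : probability T R) {n : nat}.
Context (S : {set 'I_n}) (X : 'I_n -> {RV P >-> T}).
Hypothesis iidX : iid_on D S X.
Context (B : finType) (Z : T -> B).
Hypothesis mZ : forall b, measurable (Z @^-1` [set b]).

(** Indices outside [J] carry the fixed values [y0], so adversarial and stochastic steps share one
    finite-valued history. *)
Definition record (J : {set 'I_n}) (y0 : 'I_n -> B) (w : Omega) :
    {ffun 'I_n -> B} := [ffun s => if s \in J then Z (X s w) else y0 s].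

Lemma measurable_preimage_RV s (Y : set T) :
  measurable Y -> measurable (X s @^-1` Y).
Proof. by move=> mY; rewrite -[X in measurable X]setTI; exact: measurable_funPT. Qed.

Lemma measurable_record J y0 h : measurable (record J y0 @^-1` [set h]).
Proof.
have -> : record J y0 @^-1` [set h] = \bigcap_(s in [set: 'I_n])
    (if s \in J then X s @^-1` (Z @^-1` [set h s])
     else [set w | y0 s = h s]).
  apply/seteqP; split=> [w <- s _|w hw /=].
    by rewrite ffunE; case: ifP => /= ->.
  by apply/ffunP => s; rewrite ffunE; have := hw s I; case: ifP.
apply: fin_bigcap_measurable => [|s _]; first exact: finite_finset.
case: ifP => _; first exact: measurable_preimage_RV.
have [->|ne] := eqVneq (y0 s) (h s).
  rewrite (_ : [set _ | _] = setT)//; exact/seteqP.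
rewrite (_ : [set _ | _] = set0)//; apply/seteqP; split=> // w /=.
exact/eqP.
Qed.

Lemma iid_law s b : s \in S ->
  P ((Z \o X s) @^-1` [set b]) = D (Z @^-1` [set b]).
Proof. by move=> sS; rewrite -(iidX.1 s sS _ (mZ b)). Qed.

Lemma record_independent (J : {set 'I_n}) y0 t h b :
  J \subset S -> t \in S -> t \notin J ->
  P (record J y0 @^-1` [set h] `&` (Z \o X t) @^-1` [set b]) =
  (P (record J y0 @^-1` [set h]) * D (Z @^-1` [set b]))%E.
Proof.
move=> JS tS tJ.
(* If [h] disagrees with a fixed value, the history event is empty and both sides vanish. *)
have [compat|] := pselect (forall s, s \notin J -> y0 s = h s); last first.
  move=> incompat; have -> : record J y0 @^-1` [set h] = set0.
    apply/seteqP; split=> // w hw; apply: incompat => s sJ.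
    by rewrite -hw ffunE (negbTE sJ).
  by rewrite set0I measure0 mul0e.
pose F s := if s == t then Z @^-1` [set b] else Z @^-1` [set h s].
have mF s : measurable (F s) by rewrite /F; case: ifP.
have FJ s : s \in J -> F s = Z @^-1` [set h s].
  by move=> sJ; rewrite /F; case: eqP => // st; rewrite -st sJ in tJ.
have HE : record J y0 @^-1` [set h] = \bigcap_(s in [set` J]) (X s @^-1` F s).
  apply/seteqP; split=> [w hw s /= sJ|w hw /=].
    by rewrite FJ//= -hw ffunE sJ.
  apply/ffunP => s; rewrite ffunE; case: ifPn => [sJ|/compat//].
  by have := hw s sJ; rewrite FJ.
have HtE : record J y0 @^-1` [set h] `&` (Z \o X t) @^-1` [set b] =
    \bigcap_(s in [set` t |: J]) (X s @^-1` F s).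
  rewrite HE; apply/seteqP; split=> [w [hw tw] s /=|w hw].
    rewrite in_setU1 => /predU1P[->|sJ]; last exact: hw.
    by rewrite /F eqxx.
  split=> [s sJ|]; first by apply: hw; rewrite /= in_setU1 sJ orbT.
  by have := hw t; rewrite /= in_setU1 eqxx /F eqxx; apply.
have tJS : t |: J \subset S by rewrite finset.subUset finset.sub1set tS.
rewrite HtE HE iidX.2// iidX.2// big_setU1//= muleC; congr (_ * _)%E.
by rewrite /F eqxx; exact: (iid_law b tS).
Qed.

End Independence.

(** * The stochastic optimum *)

Lemma fin_num_sum_law {R : realType} d (T : measurableType d)
    (D : probability T R) (B : finType) (Z : T -> B) (psi : B -> R) :
  (forall b, measurable (Z @^-1` [set b])) -> (forall b, 0 <= psi b) ->
  (\int[D]_x (psi (Z x))%:E)%E \is a fin_num.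
Proof.
move=> mZ psi0; rewrite integral_finite_valued//.
by apply/sum_fin_numP => b _ _; rewrite fin_numM// fin_num_measure.
Qed.

Section StochasticOptimum.
Context {R : realType} {m n : nat} (p r c : R).
Hypotheses (m0 : (0 < m)%N) (p1 : 1 <= p) (rE : r = min_p_log p m) (c0 : 0 <= c).
Context dO (Omega : measurableType dO) d (T : measurableType d).
Context (P : probability Omega R) (D : probability T R).
Context (S : {set 'I_n}) (X : 'I_n -> {RV P >-> T}) (V : T -> set 'rV[R]_m).
Hypotheses (iidX : iid_on D S X) (mV : random_set V) (jV : forall x, job (V x)).

(* For fixed weights the cheapest choice is a function of the current set alone,
   so the bound needs neither measurability of [vstar] nor a minimax argument. *)
Lemma opt_stoch_ge (A : 'I_m -> R) : (forall i, 0 <= A i) -> 0 < ell r c A ->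
  (\sum_(t in S) \int[D]_x
     (cost r A (greedy r A (profile n (V x))) / ell r c A `^ (r - 1))%:E <=
   (expR 1)%:E * opt_stoch P p S (fun t w => V (X t w)))%E.
Proof.
move=> A0 N0; have r1 : 1 <= r by rewrite rE min_p_log_ge1.
pose psi (y : {set {ffun 'I_m -> 'I_n.+2}}) := cost r A (greedy r A y) / ell r c A `^ (r - 1).
have psi0 y : 0 <= psi y by rewrite divr_ge0 ?powR_ge0 ?cost_ge0.
have mZ := @measurable_profile R m n _ _ _ mV.
have mZX t y : measurable ((fun w => profile n (V (X t w))) @^-1` [set y]).
  exact: (measurable_preimage_RV X t (mZ y)).
have mpsi t : measurable_fun setT (fun w => psi (profile n (V (X t w)))).
  exact: (measurable_finite_valued psi (mZX t)).
rewrite -lee_pdivrMl ?expR_gt0//.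
(* It suffices to compare with one selection and one measurable majorant [g] of its load: the greedy
   cost is measurable and lies pointwise below. *)
apply: le_ereal_inf_tmp => _ [vstar vstarP <-].
apply: le_ereal_inf_tmp => _ [g [mg fg] <-].
have -> : (\sum_(t in S) \int[D]_x (psi (profile n (V x)))%:E =
    \int[P]_w (\sum_(t in S) psi (profile n (V (X t w))))%:E)%E.
  under [RHS]eq_integral do rewrite -sumEFin -big_enum.
  rewrite ge0_integral_sum//=; last 2 first.
  - by move=> t; apply/measurable_EFinP; exact: mpsi.
  - by move=> t w _; rewrite lee_fin.
  rewrite big_enum/=; apply: eq_bigr => t tS.
  rewrite (integral_finite_valued P (mZX t))// (integral_finite_valued D mZ)//.
  by apply: eq_bigr => y _; rewrite -(iid_law iidX mZ y tS).
have msum : measurable_fun setT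
    (fun w => (\sum_(t in S) psi (profile n (V (X t w))))%:E).
  apply/measurable_EFinP; under eq_fun do rewrite -big_enum/=.
  exact: measurable_sum.
have sum0 w : (0 <= (\sum_(t in S) psi (profile n (V (X t w))))%:E)%E.
  by rewrite lee_fin sumr_ge0.
rewrite -ge0_integralZl_EFin ?invr_ge0 ?expR_ge0//.
apply: ge0_le_integral => //.
- by move=> w _; rewrite mule_ge0// lee_fin invr_ge0 expR_ge0.
- exact: measurable_funeM.
move=> w _; apply: le_trans (fg w).
rewrite -EFinM lee_fin ler_pdivrMl ?expR_gt0//.
pose b i := \sum_(t in S) vstar (V (X t w)) ord0 i.
have v0 t i : 0 <= vstar (V (X t w)) ord0 i.
  have [_ V01] := jV (X t w).
  by have /andP[] := V01 _ (vstarP _ (jV (X t w))) i.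
have b0 i : 0 <= b i by exact: sumr_ge0.
have -> : pnorm p (\sum_(t in S) vstar (V (X t w))) = ell p 0 b.
  rewrite pnormE; congr ell; apply/funext => i.
  by rewrite summxE ger0_norm// b0.
apply: le_trans (_ : ell r 0 b <= _); last by rewrite rE ell_min_p_log.
rewrite /psi -mulr_suml ler_pdivrMr ?(powR_gt0 _ N0)// mulrC.
(* Greedy is at most as costly as [vstar] in every step; Hoelder then bounds the total cost of
   [vstar] by the norm of its load. *)
apply: (@le_trans _ _ (\sum_i A i `^ (r - 1) * b i)).
  under [leRHS]eq_bigr do rewrite /b mulr_sumr.
  rewrite [leRHS]exchange_big/=; apply: ler_sum => t _.
  by apply: cost_greedy_le; [exact: jV|exact: vstarP].
apply: ell_holder => //; by rewrite ell_powR// lerDr.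
Qed.

End StochasticOptimum.

(** * The expected load of the greedy algorithm *)

Section ExpectedLoad.
Context {R : realType} {m n : nat} (p r : R).
Hypotheses (m0 : (0 < m)%N) (p1 : 1 <= p) (rE : r = min_p_log p m).
Context (Adv : {set 'I_n}) (U : 'I_n -> set 'rV[R]_m).
Context dO (Omega : measurableType dO) d (T : measurableType d).
Context (P : probability Omega R) (D : probability T R).
Context (X : 'I_n -> {RV P >-> T}) (V : T -> set 'rV[R]_m).
Hypotheses (jU : forall t, t \in Adv -> job (U t)).
Hypotheses (mV : random_set V) (jV : forall x, job (V x)).
Hypothesis iidX : iid_on D (~: Adv) X.

Let jobs (w : Omega) (t : 'I_n) := if t \in Adv then U t else V (X t w).
Let Z x := profile n (V x).
Let Y := record X Z (~: Adv) (fun t => profile n (U t)).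

Let r1 : 1 <= r. Proof. by rewrite rE min_p_log_ge1. Qed.

Let mZ y : measurable (Z @^-1` [set y]).
Proof. exact: measurable_profile. Qed.

Let jobs_job w t : job (jobs w t).
Proof. by rewrite /jobs; case: ifP => [/jU|_]. Qed.

Let YE w : (Y w : 'I_n -> _) = @profile R m n \o jobs w.
Proof.
by apply/funext => t; rewrite /Y ffunE inE /jobs /=; case: (t \in Adv).
Qed.

(** The directional derivative of [ell r c] at the current load along the greedy grid point. The
    history [h] and the current profile [y] are separate arguments so that they can be averaged
    independently. *)
Definition normalized_cost c t (h : 'I_n -> {set {ffun 'I_m -> 'I_n.+2}})
    (y : {set {ffun 'I_m -> 'I_n.+2}}) : R :=
  cost r (traj r h t) (greedy r (traj r h t) y) / ell r c (traj r h t) `^ (r - 1).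

Let traj_ge0 (h : 'I_n -> {set {ffun 'I_m -> 'I_n.+2}}) t i : 0 <= traj r h t i.
Proof. by apply: le_trans (traj_ge _ _ _ _); apply: le_trans r1. Qed.

Let ell_traj_gt0 c (h : 'I_n -> {set {ffun 'I_m -> 'I_n.+2}}) t : 0 <= c ->
  0 < ell r c (traj r h t).
Proof.
move=> c0; apply: lt_le_trans (le_ellc _ r1 c0).
apply: lt_le_trans (ell_coord r1 (traj_ge0 h t (Ordinal m0))).
by apply: lt_le_trans (traj_ge _ _ _ _); apply: lt_le_trans r1.
Qed.

Let normalized_cost_ge0 c t h y : 0 <= normalized_cost c t h y.
Proof. by rewrite divr_ge0 ?powR_ge0 ?cost_ge0. Qed.

(** For a frozen history all stochastic steps have the same expected cost, and [opt_stoch_ge] bounds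
    the sum of these equal terms, hence each one by its share. *)
Lemma integral_normalized_cost c s (t : 'I_n) : 0 <= c -> t \notin Adv ->
  opt_stoch P p (~: Adv) (fun t w => V (X t w)) = s%:E ->
  (\int[P]_w (normalized_cost c t (Y w) (Y w t))%:E <=
   (expR 1 * s / #|~: Adv|%:R)%:E)%E.
Proof.
move=> c0 tA sE; have tS : t \in ~: Adv by rewrite inE.
(* Entries from time [t] on are frozen; the trajectory at time [t] reads only earlier ones. *)
pose J := [set u in ~: Adv | (u < t)%N]%SET.
pose H := record X Z J (fun u => profile n (U u)).
have -> : (\int[P]_w (normalized_cost c t (Y w) (Y w t))%:E =
    \int[P]_w (normalized_cost c t (H w) ((Z \o X t) w))%:E)%E.
  apply: eq_integral => w _.
  have -> : Y w t = (Z \o X t) w by rewrite /Y ffunE tS.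
  have E : traj r (Y w) t = traj r (H w) t.
    congr loads; apply: eq_hist => u ut.
    by rewrite /Y /H !ffunE [in RHS]inE ut andbT.
  by rewrite /normalized_cost E.
apply: (@integral_independent _ _ _ _ _ _ H (Z \o X t) _ _ D Z
  (fun h => normalized_cost c t h)).
- exact: measurable_record.
- by move=> y; apply: (measurable_preimage_RV X t (mZ y)).
- exact: mZ.
- move=> h y; apply: (record_independent iidX mZ) => //.
    by apply/fintype.subsetP => u; rewrite inE => /andP[].
  by rewrite inE ltnn andbF.
- by move=> h y; exact: normalized_cost_ge0.
move=> h.
have := opt_stoch_ge m0 p1 rE c0 iidX mV jV (traj_ge0 h t) (ell_traj_gt0 h t c0).
rewrite sE -EFinM.
have := fin_num_sum_law D mZ (normalized_cost_ge0 c t h).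
rewrite /normalized_cost => /fineK <-.
rewrite sumEFin !lee_fin sumr_const ler_pdivlMr ?mulr_natr// ltr0n.
by apply/card_gt0P; exists t.
Qed.

Lemma greedy_alg_expected_load (v : 'I_n -> 'rV[R]_m) (s : R) :
  (forall t, t \in Adv -> U t (v t)) ->
  opt_stoch P p (~: Adv) (fun t w => V (X t w)) = s%:E -> 0 <= s ->
  (outer_expectation P
     (fun w => pnorm p (\sum_(t < n) run (greedy_alg n r) (jobs w) t)) <=
   (2 * expR 1 ^+ 2 * s +
    4 * expR 1 ^+ 2 * r * pnorm p (\sum_(t in Adv) v t) +
    2 * expR 1 * (r * m%:R `^ p^-1))%:E)%E.
Proof.
move=> Uv sE s0; have e0 := expR_gt0 (1 : R); have r0 : 0 < r by exact: lt_le_trans r1.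
have b0 t i : t \in Adv -> 0 <= v t ord0 i.
  move=> tA; have [_ U01] := jU tA.
  by have /andP[] := U01 _ (Uv _ tA) i.
set a := pnorm p _; have a0 : 0 <= a by exact: powR_ge0.
(* The lower bound on [Phi 0] demanded by [potential_bound], with [expR 1 * a] bounding the l_r norm
   of the adversarial comparison load; [c] encodes one constant coordinate equal to [M]. *)
pose M := 2 * expR 1 * r * (expR 1 * a).
have M0 : 0 <= M by rewrite !mulr_ge0// ltW.
pose c := M `^ r; have c0 : 0 <= c by exact: powR_ge0.
pose Phi0 := ell r c (fun _ : 'I_m => r).
(* A function of the finite-valued [Y], hence a measurable majorant of the load, which bounds the
   outer expectation. *)
pose G w := 2 * Phi0 + 2 * expR 1 *
  \sum_(t in ~: Adv) normalized_cost c t (Y w) (Y w t).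
have load_le w : pnorm p (\sum_(t < n) run (greedy_alg n r) (jobs w) t) <= G w.
  have load i := load_le_traj i r1 (jobs_job w).
  apply: (@le_trans _ _ (ell r c (traj r (Y w) n))).
    rewrite pnormE; apply: (@le_trans _ _ (ell r 0 (fun i =>
        `|(\sum_(t < n) run (greedy_alg n r) (jobs w) t) ord0 i|))).
      by apply: ell_nonincreasing; rewrite // rE min_p_log_le.
    apply: le_trans (le_ellc _ r1 c0); apply: le_ell => // i.
    by have /andP[l0 l1] := load i; rewrite ger0_norm// l0 YE.
  have traj0E : traj r (Y w) 0 = fun=> r by apply/funext => i; rewrite traj0.
  have := @potential_bound R m r c (traj r (Y w))
    (fun t => ell r c (traj r (Y w) t)) r1 c0 (traj_ge _ _) (traj_inc _ _)
    (fun=> erefl) (ell_traj_gt0 _ 0 c0) n (fun t => t \in Adv)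
    (fun t i => v t ord0 i).
  have costE (t : 'I_n) : \sum_i traj r (Y w) t i `^ (r - 1) *
      (traj r (Y w) t.+1 i - traj r (Y w) t i) =
      cost r (traj r (Y w) t) (greedy r (traj r (Y w) t) (Y w t)).
    by apply: eq_bigr => i _; rewrite trajS addrAC subrr add0r.
  rewrite traj0E; move=> /(_ (fun t i => b0 t i)) H.
  apply: (le_trans (H _ _)).
  - move=> t tA; rewrite costE.
    have -> : Y w t = profile n (U t) by rewrite YE /= /jobs tA.
    by apply: cost_greedy_le; [exact: jU|exact: Uv].
  - apply: le_trans (le_cst_ell _ r1 M0).
    rewrite ler_wpM2l ?mulr_ge0 ?(ltW e0) ?(ltW r0)//.
    have -> : a = ell p 0 (fun i => \sum_(t < n | t \in Adv) v t ord0 i).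
      rewrite /a pnormE; congr ell; apply/funext => i.
      by rewrite summxE ger0_norm// sumr_ge0// => t; exact: b0.
    rewrite rE; apply: ell_min_p_log => // i.
    by apply: sumr_ge0 => t; exact: b0.
  rewrite lerD2l ler_wpM2l ?mulr_ge0 ?(ltW e0)//.
  rewrite le_eqVlt; apply/orP; left; apply/eqP.
  by apply: eq_big => [t|t _]; rewrite ?inE// costE.
have mtheta (t : 'I_n) : measurable_fun setT (fun w => normalized_cost c t (Y w) (Y w t)).
  exact: (measurable_finite_valued
    (fun h : {ffun 'I_n -> {set {ffun 'I_m -> 'I_n.+2}}} =>
       normalized_cost c t h (h t)) (measurable_record X mZ _ _)).
have msum : measurable_fun setT
    (fun w => \sum_(t in ~: Adv) normalized_cost c t (Y w) (Y w t)).
  under eq_fun do rewrite -big_enum/=.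
  by apply: measurable_sum => t; exact: mtheta.
have sum0 w : 0 <= \sum_(t in ~: Adv) normalized_cost c t (Y w) (Y w t).
  by apply: sumr_ge0 => t _; exact: normalized_cost_ge0.
have Phi00 : 0 <= Phi0 by exact: ell_ge0.
apply: (@le_trans _ _ (\int[P]_w (G w)%:E)%E).
  apply: ereal_inf_lbound; exists (EFin \o G) => //; split.
    apply/measurable_EFinP; apply: measurable_funD; first exact: measurable_cst.
    by apply: measurable_funM => //; exact: measurable_cst.
  by move=> w; rewrite lee_fin.
under eq_integral do rewrite /G EFinD [X in (_ + X)%E]EFinM.
rewrite ge0_integralD//; last 3 first.
- by move=> w _; rewrite lee_fin mulr_ge0.
- by move=> w _; rewrite mule_ge0// lee_fin// mulr_ge0// ltW.
- by apply: measurable_funeM; exact/measurable_EFinP.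
rewrite ge0_integralZl_EFin ?mulr_ge0 ?(ltW e0)//; last 2 first.
- by move=> w _; rewrite lee_fin.
- exact/measurable_EFinP.
have -> : (\int[P]_w (2 * Phi0)%:E = (2 * Phi0)%:E)%E.
  by rewrite integral_cst// -[RHS]mule1; congr (_ * _)%E; exact: probability_setT.
have sum_le : (\int[P]_w (\sum_(t in ~: Adv) normalized_cost c t (Y w) (Y w t))%:E <=
    (expR 1 * s)%:E)%E.
  under eq_integral do rewrite -sumEFin -big_enum.
  rewrite ge0_integral_sum//=; last 2 first.
  - by move=> t; apply/measurable_EFinP; exact: mtheta.
  - by move=> t w _; rewrite lee_fin normalized_cost_ge0.
  rewrite big_enum/=.
  apply: (@le_trans _ _ (\sum_(t in ~: Adv) (expR 1 * s / #|~: Adv|%:R)%:E)%E).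
    apply: lee_sum => t; rewrite inE => tA.
    exact: integral_normalized_cost.
  rewrite sumEFin lee_fin sumr_const -[leLHS]mulr_natr.
  have [->|k0] := eqVneq (#|~: Adv|%:R : R) 0.
    by rewrite mulr0 mulr_ge0 ?(ltW e0).
  by rewrite divfK.
apply: (@le_trans _ _ ((2 * Phi0)%:E + (2 * expR 1)%:E * (expR 1 * s)%:E)%E).
  by rewrite leeD2l// lee_wpmul2l// lee_fin mulr_ge0// ltW.
rewrite -EFinM -EFinD lee_fin.
have : Phi0 <= M + r * (expR 1 * m%:R `^ p^-1).
  apply: le_trans (ell_add_cst_le _ r1 M0) _.
  rewrite lerD2l (ell_cst r1 (ltW r0)) ler_wpM2l ?(ltW r0)// rE.
  exact: powR_min_p_log.
by rewrite /M; lra.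
Qed.

End ExpectedLoad.

(** * Passage to the optima and choice of the constants *)

Theorem theorem2 (R : realType) :
  exists C1 C2 C3 : R,
  forall (m n : nat) (p : R), (0 < m)%N -> 1 <= p ->
  exists alg : online_alg R m, valid_alg n alg /\
  forall (Adv : {set 'I_n}) (U : 'I_n -> set 'rV[R]_m)
    (d : measure_display) (T : measurableType d) (D : probability T R)
    (V : T -> set 'rV[R]_m)
    (dO : measure_display) (Omega : measurableType dO)
    (P : probability Omega R) (X : 'I_n -> {RV P >-> T}),
  (forall t, t \in Adv -> job (U t)) ->
  random_set V -> (forall x, job (V x)) ->
  iid_on D (~: Adv) X ->
  let jobs (w : Omega) (t : 'I_n) := if t \in Adv then U t else V (X t w) in
  (outer_expectation P (fun w => pnorm p (\sum_(t < n) run alg (jobs w) t)%R)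
   <= C1%:E * opt_stoch P p (~: Adv) (fun t w => V (X t w))
      + (C2 * min_p_log p m)%:E * opt_adv p Adv U
      + (C3 * (min_p_log p m * m%:R `^ p^-1))%:E)%E.
Proof.
exists (2 * expR 1 ^+ 2), (4 * expR 1 ^+ 2), (2 * expR 1 + 4 * expR 1 ^+ 2).
move=> m n p m0 p1; exists (greedy_alg n (min_p_log p m)).
split; first exact: valid_greedy_alg.
move=> Adv U d T D V dO Omega P X jU mV jV iidX; cbv zeta.
set r := min_p_log p m; have r1 : 1 <= r by exact: min_p_log_ge1.
have e0 := expR_gt0 (1 : R); have e20 : 0 < expR 1 ^+ 2 :> R by exact: exprn_gt0.
have mp1 : 1 <= m%:R `^ p^-1 :> R.
  rewrite -[leLHS](powRr0 (m%:R : R)); apply: ler_powR; first by rewrite ler1n.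
  by rewrite invr_ge0; lra.
have adv0 : (0 <= opt_adv p Adv U)%E.
  apply: le_ereal_inf_tmp => _ [v _ <-]; rewrite lee_fin; exact: powR_ge0.
have adv_fin : opt_adv p Adv U \is a fin_num.
  pose v t := xget 0 (U t).
  have Uv t : t \in Adv -> U t (v t).
    by move=> /jU[[u Uu] _]; apply: xgetPex; exists u.
  rewrite ge0_fin_numE//; apply: le_lt_trans (ltry (pnorm p (\sum_(t in Adv) v t))).
  by apply: ereal_inf_lbound; exists v.
have sto0 : (0 <= opt_stoch P p (~: Adv) (fun t w => V (X t w)))%E.
  apply: le_ereal_inf_tmp => _ [vs _ <-].
  apply: le_ereal_inf_tmp => _ [g [_ fg] <-].
  apply: integral_ge0 => w _; apply: le_trans (fg w); rewrite lee_fin; exact: powR_ge0.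
(* The adversarial infimum need not be attained, so a selection within 1 of it is taken; the extra
   [4 * expR 1 ^+ 2] in the third constant pays for this, as [m ^ (1 / p) >= 1]. *)
have [v Uv va] := lb_ereal_inf_adherent (@ltr01 R) adv_fin.
case: Uv va => u Uu <- va.
case sE : (opt_stoch P p (~: Adv) (fun t w => V (X t w))) sto0 => [s| |]//= sto0.
  have := greedy_alg_expected_load m0 p1 erefl jU mV jV iidX Uu sE sto0.
  move=> /le_trans; apply.
  move: va; rewrite -/(opt_adv p Adv U) -(fineK adv_fin) -EFinD lte_fin => va.
  rewrite -!EFinM -!EFinD lee_fin -/r.
  have : 4 * expR 1 ^+ 2 * r * pnorm p (\sum_(t in Adv) u t) <=
      4 * expR 1 ^+ 2 * r * (fine (opt_adv p Adv U) + 1).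
    by rewrite ler_wpM2l ?(ltW va)// !mulr_ge0//; lra.
  have : 4 * expR 1 ^+ 2 * r * 1 <= 4 * expR 1 ^+ 2 * r * m%:R `^ p^-1 :> R.
    by rewrite ler_wpM2l// !mulr_ge0//; lra.
  lra.
(* The stochastic optimum is infinite here, and so is the right-hand side. *)
rewrite gt0_muley ?lte_fin ?mulr_gt0//.
rewrite -(fineK adv_fin) -EFinM; exact: leey.
Qed.
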